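(* Let $Y$ be a separated locally convex space, let $A$ be a proper closed convex subset of $Y$, and let $k\in-\operatorname{int}0^+A$. Then $\varphi_{A,k}$ is a finite-valued continuous convex function, $\varphi_{0^+A,k}$ is a finite-valued continuous sublinear function, and for each $\overline{y}\in Y$: $$y^*\in\partial\varphi_{A,k}(\overline{y})\implies y^*(y-\overline{y})\le\varphi_{0^+A,k}(y-\overline{y})\quad\forall y\in Y.$$
   Context: Vector spaces are real; ''separated'' means Hausdorff. ''Proper subset of $Y$'' means nonempty and different from $Y$. $0^+A=\{u\in Y\mid a+tu\in A\ \forall a\in A,\ \forall t\ge0\}$ is the recession cone. $\nu$ is a symbolic value not in $\overline{\mathbb{R}}=\mathbb{R}\cup\{\pm\infty\}$, and $\inf\emptyset:=\nu$. For $M\subseteq Y$ and $k\neq0$, $\varphi_{M,k}:Y\to\overline{\mathbb{R}}\cup\{\nu\}$ is $\varphi_{M,k}(y)=\inf\{t\in\mathbb{R}\mid y\in tk+M\}$; it is finite-valued if $\varphi_{M,k}(y)\in\mathbb{R}$ for all $y\in Y$ (the assumptions force $k\ne0$). For a finite-valued $\varphi$, $\partial\varphi(\overline y)$ is the set of continuous linear functionals $y^*$ on $Y$ with $y^*(y-\overline y)\le\varphi(y)-\varphi(\overline y)$ for all $y\in Y$. *)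

(* Defs.v *)
From HB Require Import structures.
From mathcomp Require Import all_boot all_order all_algebra.
From mathcomp Require Import all_classical all_reals all_analysis.
Import Order.TTheory GRing.Theory Num.Theory.
Import numFieldNormedType.Exports.

Set Implicit Arguments.
Unset Strict Implicit.
Unset Printing Implicit Defensive.

Local Open Scope classical_set_scope.
Local Open Scope ring_scope.

Definition recession_cone (R : realType) (Y : lmodType R) (A : set Y) : set Y :=
  [set u | forall a, A a -> forall t : R, 0 <= t -> A (a + t *: u)].

(* [option (\bar R)] is the extended real line with one extra symbol adjoined:
   [None] is nu, so that the infimum of the empty set is nu, not +oo. *)
Definition inf_nu (R : realType) (S : set R) : option (\bar R) :=
  if S == set0 then None else Some (ereal_inf [set t%:E | t in S]).

Definition phi (R : realType) (Y : lmodType R) (M : set Y) (k y : Y) :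
    option (\bar R) :=
  inf_nu [set t : R | [set t *: k + m | m in M] y].

Definition finite_valued (R : realType) (T : Type) (f : T -> option (\bar R)) :=
  forall y, exists r : R, f y = Some r%:E.

(* Meaningful for finite-valued [f] only: the default value 0 for nu, -oo
   and +oo is then never used. *)
Definition real_fun (R : realType) (T : Type) (f : T -> option (\bar R))
    (y : T) : R :=
  if f y is Some x then fine x else 0.

Definition sublinear (R : realType) (Y : lmodType R) (f : Y -> R) :=
  (forall x y, f (x + y) <= f x + f y) /\
  (forall (t : R) x, 0 <= t -> f (t *: x) = t * f x).

Definition subdifferential (R : realType) (Y : tvsType R) (f : Y -> R)
    (ybar : Y) : set {linear Y -> R^o} :=
  [set ystar | continuous ystar /\
    forall y, ystar (y - ybar) <= f y - f ybar].

(* Main.v *)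
Require Import Defs.
From HB Require Import structures.
From mathcomp Require Import all_boot all_order all_algebra.
From mathcomp Require Import all_classical all_reals all_analysis.
From mathcomp Require Import lra.
Import Order.TTheory GRing.Theory Num.Theory.
Import numFieldNormedType.Exports.

Set Implicit Arguments.
Unset Strict Implicit.
Unset Printing Implicit Defensive.

Local Open Scope classical_set_scope.
Local Open Scope ring_scope.

(** Write [C] for the recession cone of [A]; it is a convex cone with
    [A + C `<=` A] and, by hypothesis, a neighbourhood of [- k].  The value of
    [phi M k] at [y] is the infimum of the set [shifts M k y] of all [t] with
    [y - t *: k] in [M], and everything follows from the way [C] acts on a set
    [M] with [M + C `<=` M]; both [A] and [C] itself are such sets.

    - Since [C] is a neighbourhood of [- k], every vector is brought into [C] by
      subtracting a large multiple of [k] ([cone_absorbs]).  Hence [shifts M k y]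
      is nonempty as soon as [M] is, and it is bounded below unless [M] is the
      whole space ([has_inf_shifts]): this is finiteness.
    - From [M + C `<=` M] one gets the mixed subadditivity
      [phi M (x + y) <= phi M x + phi C y] ([real_fun_phi_add]).
    - [phi C] is below any prescribed [e > 0] near [0], because
      [z - e *: k] lies in [C] for small [z] ([phi_cone_small]).  Together with
      mixed subadditivity, applied to the increments [z] and [- z], this bounds
      the oscillation of [phi M]: continuity ([continuous_of_subadd]).
    - Convexity of [phi A] and homogeneity of [phi C] come from the corresponding
      properties of the sets of shifts, and subadditivity of [phi C] is the case
      [M = C] of mixed subadditivity.
    - If [ystar] is a subgradient of [phi A] at [ybar], then
      [ystar z <= phi A (ybar + z) - phi A ybar <= phi C z], again by mixed
      subadditivity. *)

(** * The recession cone *)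

Section RecessionCone.
Variables (R : realType) (Y : lmodType R) (A : set Y).

Lemma recession_cone_act a u : A a -> recession_cone A u -> A (a + u).
Proof. by move=> Aa /(_ _ Aa 1 ler01); rewrite scale1r. Qed.

Lemma recession_coneD u v :
  recession_cone A u -> recession_cone A v -> recession_cone A (u + v).
Proof.
move=> Cu Cv a Aa t t0; rewrite scalerDr addrA.
by apply: Cv => //; exact: Cu.
Qed.

Lemma recession_coneZ (s : R) u :
  0 <= s -> recession_cone A u -> recession_cone A (s *: u).
Proof.
by move=> s0 Cu a Aa t t0; rewrite scalerA; apply: Cu => //; exact: mulr_ge0.
Qed.

Lemma recession_cone0 : recession_cone A 0.
Proof. by move=> a Aa t _; rewrite scaler0 addr0. Qed.

Lemma recession_cone_neqT :
  A !=set0 -> A <> [set: Y] -> recession_cone A <> [set: Y].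
Proof.
move=> [a Aa] AT CT; apply: AT; apply/seteqP; split=> // y _.
by rewrite -(subrK a y) addrC; apply: recession_cone_act; rewrite // CT.
Qed.

End RecessionCone.

(** * The functional as an infimum of shifts *)

Definition shifts (R : realType) (Y : lmodType R) (M : set Y) (k y : Y) : set R :=
  [set t | M (y - t *: k)].

Section Shifts.
Variables (R : realType) (Y : lmodType R).
Implicit Types (M C : set Y) (k x y : Y).

Lemma phi_shifts M k y : has_inf (shifts M k y) ->
  phi M k y = Some (inf (shifts M k y))%:E.
Proof.
rewrite /phi => -[S0 lbS].
have -> : [set t | [set t *: k + m | m in M] y] = shifts M k y.
  apply/seteqP; split=> t /=; rewrite /shifts /=.
    by move=> [m Mm <-]; rewrite addrC addKr.
  by move=> My; exists (y - t *: k) => //; rewrite addrC subrK.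
by rewrite /inf_nu ifN ?ereal_inf_EFin //; apply/set0P.
Qed.

End Shifts.

(** * Limits in topological vector spaces *)

Section TvsLimits.
Variables (R : realType) (Y : tvsType R) (T : Type) (F : set_system T).
Context {FF : Filter F}.

Lemma tvs_cvgB (f g : T -> Y) (a b : Y) :
  f x @[x --> F] --> a -> g x @[x --> F] --> b ->
  f x - g x @[x --> F] --> a - b.
Proof.
by apply: (@continuous2_cvg _ _ _ _ _ _ f g (fun u v : Y => u - v));
  exact: (@sub_continuous Y (a, b)).
Qed.

Lemma tvs_cvgZ (f : T -> R^o) (g : T -> Y) (a : R) (b : Y) :
  f x @[x --> F] --> (a : R^o) -> g x @[x --> F] --> b ->
  f x *: g x @[x --> F] --> a *: b.
Proof.
by apply: (@continuous2_cvg _ _ _ _ _ _ f g (fun (s : R^o) (v : Y) => s *: v));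
  exact: (@scale_continuous R Y (a, b)).
Qed.

End TvsLimits.

(** * Sets stable under a cone with [- k] in its interior *)

Section ConeAction.
Variables (R : realType) (Y : tvsType R) (C : set Y) (k : Y).
Hypothesis coneD : forall u v, C u -> C v -> C (u + v).
Hypothesis coneZ : forall (s : R) u, 0 <= s -> C u -> C (s *: u).
Hypothesis nbhs_cone : nbhs (- k) C.

(** [s *: x - k] tends to [- k] as [s] tends to [0], so it belongs to [C] for some
    [s > 0]; scaling by [s^-1] then yields the shift [s^-1]. *)
Lemma cone_absorbs x : exists s : R, C (x - s *: k).
Proof.
have cvgk : (s *: x - k @[s --> (0 : R^o)] --> (0 : R) *: x - k)%classic.
  by apply: tvs_cvgB; [apply: tvs_cvgZ; [exact: cvg_id|]|]; exact: cvg_cst.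
rewrite scale0r add0r in cvgk.
have /cvg_at_right_filter cvgkr := cvgk.
have [s [s0 Cs]] : exists s : R, 0 < s /\ C (s *: x - k).
  apply: (@filter_ex _ (0 : R)^'+); apply: filterI; last exact: cvgkr.
  exact: nbhs_right_gt.
exists s^-1.
rewrite (_ : x - _ = s^-1 *: (s *: x - k)); last first.
  by rewrite scalerBr scalerA mulVf ?scale1r// gt_eqF.
by apply: coneZ; rewrite // invr_ge0 ltW.
Qed.

(** Write [z - e *: k] as [e *: (e^-1 *: z - k)]: the second factor tends to [- k]
    as [z] tends to [0]. *)
Lemma cone_near0 e : 0 < e -> \forall z \near (0 : Y), C (z - e *: k).
Proof.
move=> e0.
have cvgk : (e^-1 *: z - k @[z --> (0 : Y)] --> e^-1 *: (0 : Y) - k)%classic.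
  apply: tvs_cvgB; last exact: cvg_cst.
  by apply: tvs_cvgZ; [exact: cvg_cst|exact: cvg_id].
rewrite scaler0 add0r in cvgk.
near=> z.
rewrite (_ : z - _ = e *: (e^-1 *: z - k)).
  apply: coneZ; first exact: ltW.
  by near: z; exact: cvgk.
by rewrite scalerBr scalerA divff ?scale1r// gt_eqF.
Unshelve. all: by end_near. Qed.

Section StableSet.
Variable M : set Y.
Hypothesis M_act : forall a u, M a -> C u -> M (a + u).
Hypothesis M_neq0 : M !=set0.
Hypothesis M_neqT : M <> [set: Y].

Lemma shifts_up y (t s : R) : t <= s -> shifts M k y t -> shifts M k y s.
Proof.
move=> ts Myt; rewrite /shifts/=.
rewrite (_ : _ - _ = y - t *: k + (s - t) *: - k).
  apply: M_act => //; apply: coneZ; first by rewrite subr_ge0.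
  exact: nbhs_singleton nbhs_cone.
by rewrite scalerN scalerBl opprB addrA subrK.
Qed.

(** If [shifts M k y] were unbounded below, [M] would contain the whole line
    [y + R *: k]; every vector is reached from that line by adding an element of
    [C], so [M] would be the whole space. *)
Lemma has_inf_shifts y : has_inf (shifts M k y).
Proof.
split.
  have [a Ma] := M_neq0; have [s Cs] := cone_absorbs (y - a).
  exists s; rewrite /shifts/= (_ : y - _ = a + (y - a - s *: k)).
    exact: M_act.
  by rewrite addrA (addrC a) subrK.
have /existsNP[z Mz] : ~ forall z, M z.
  by move=> MT; apply: M_neqT; apply/seteqP; split.
have [s Cs] := cone_absorbs (z - y).
exists (- s) => t Myt; rewrite leNgt; apply/negP => /ltW ts; apply: Mz.
rewrite (_ : z = y - (- s) *: k + (z - y - s *: k)).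
  exact: M_act (shifts_up ts Myt) Cs.
by rewrite scaleNr opprK addrACA subrr addr0 addrC subrK.
Qed.

Lemma real_fun_phi y : real_fun (phi M k) y = inf (shifts M k y).
Proof. by rewrite /real_fun phi_shifts //; exact: has_inf_shifts. Qed.

Lemma finite_valued_phi : finite_valued (phi M k).
Proof.
by move=> y; exists (inf (shifts M k y)); exact: phi_shifts (has_inf_shifts y).
Qed.

Lemma real_fun_phi_le y t : shifts M k y t -> real_fun (phi M k) y <= t.
Proof.
by rewrite real_fun_phi; apply: ge_inf; case: (has_inf_shifts y).
Qed.

Lemma real_fun_phi_ge y l :
  (forall t, shifts M k y t -> l <= t) -> l <= real_fun (phi M k) y.
Proof.
by rewrite real_fun_phi => ?; apply: lb_le_inf => //; case: (has_inf_shifts y).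
Qed.

(** If [x - a *: k] and [y - b *: k] lie in [M], so does their convex
    combination, whose shift is the same combination of [a] and [b]; take [a] and
    [b] within [e] of the two infima. *)
Lemma convex_real_fun_phi : @convex_set R Y M ->
  @convex_function R Y [set: Y] (real_fun (phi M k)).
Proof.
move=> Mconv p x y _ _; rewrite !real_fun_phi.
rewrite -[leRHS]/(p%:num * inf (shifts M k x) +
                  (1 - p%:num) * inf (shifts M k y)).
apply/ler_addgt0Pr => e e0.
have [a Ma alt] := inf_adherent e0 (has_inf_shifts x).
have [b Mb blt] := inf_adherent e0 (has_inf_shifts y).
have p0 : 0 <= p%:num by [].
have q0 : 0 <= (1 - p%:num) by rewrite subr_ge0.
apply: (@le_trans _ _ (p%:num * a + (1 - p%:num) * b)); last first.
  apply: (@le_trans _ _ (p%:num * (inf (shifts M k x) + e) +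
                         (1 - p%:num) * (inf (shifts M k y) + e))).
    by apply: lerD; apply: ler_wpM2l => //; exact: ltW.
  lra.
rewrite -real_fun_phi; apply: real_fun_phi_le; rewrite /shifts /=.
have := Mconv (x - a *: k) (y - b *: k) p; rewrite !inE => /(_ Ma Mb).
congr (M _).
rewrite -[LHS]/(p%:num *: (x - a *: k) + (1 - p%:num) *: (y - b *: k)).
rewrite -[X in _ = X - _]/(p%:num *: x + (1 - p%:num) *: y).
by rewrite !scalerBr !scalerA (scalerDl k) opprD addrACA.
Qed.

End StableSet.

Section ConeFunctional.
Hypothesis C_neqT : C <> [set: Y].
Hypothesis C0 : C 0.

Let phiC := real_fun (phi C k).
Let C_neq0 : C !=set0. Proof. by exists 0. Qed.

(** Shifts add up: [x - a *: k] in [M] and [y - b *: k] in [C] give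
    [x + y - (a + b) *: k] in [M + C]. *)
Lemma real_fun_phi_add (M : set Y) :
    (forall a u, M a -> C u -> M (a + u)) -> M !=set0 -> M <> [set: Y] ->
  forall x y, real_fun (phi M k) (x + y) <= real_fun (phi M k) x + phiC y.
Proof.
move=> M_act M0 MT x y; rewrite -lerBlDl; apply: real_fun_phi_ge => // b Cb.
rewrite lerBlDl -lerBlDr; apply: real_fun_phi_ge => // a Ma.
rewrite lerBlDr; apply: real_fun_phi_le => //.
by rewrite /shifts /= scalerDl opprD addrACA; exact: M_act.
Qed.

Lemma phi_cone_small e : 0 < e -> \forall z \near (0 : Y), phiC z <= e.
Proof.
by move/cone_near0; apply: filterS => z Cz; exact: real_fun_phi_le.
Qed.

(** For [t > 0], multiplication by [t] maps the shifts of [x] to those of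
    [t *: x]; applied to [t^-1] as well this gives equality.  The case [t = 0]
    follows from [phiC 0 = 2 * phiC 0]. *)
Lemma phi_coneZ (t : R) x : 0 <= t -> phiC (t *: x) = t * phiC x.
Proof.
have leZ s y : 0 < s -> phiC (s *: y) <= s * phiC y.
  move=> s0; rewrite mulrC -ler_pdivrMr //; apply: real_fun_phi_ge => // a Ca.
  rewrite ler_pdivrMr // mulrC; apply: real_fun_phi_le => //.
  by rewrite /shifts /= -scalerA -scalerBr; apply: coneZ => //; exact: ltW.
have eqZ s y : 0 < s -> phiC (s *: y) = s * phiC y.
  move=> s0; apply/eqP; rewrite eq_le leZ //=.
  rewrite mulrC -ler_pdivlMr // mulrC.
  rewrite (_ : phiC y = phiC (s^-1 *: (s *: y))).
    by apply: leZ; rewrite invr_gt0.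
  by rewrite scalerA mulVf ?scale1r // gt_eqF.
rewrite le_eqVlt => /orP[/eqP <-|]; last exact: eqZ.
have := eqZ 2 0 (ltr0n _ 2); rewrite scaler0 scale0r mul0r; lra.
Qed.

End ConeFunctional.
End ConeAction.

(** * Continuity from subadditive control of increments *)

(** The increment by [z] gives [f (y + z) - f y <= g z], and going back from
    [y + z] to [y] gives [f y - f (y + z) <= g (- z)]; both right-hand sides are
    small when [z] is close to [0]. *)
Lemma continuous_of_subadd (R : realType) (Y : tvsType R) (f g : Y -> R) :
  (forall x y, f (x + y) <= f x + g y) ->
  (forall e, 0 < e -> \forall z \near (0 : Y), g z <= e) -> continuous f.
Proof.
move=> fg gsmall y; apply/cvgrPdist_le => e e0.
have cvgB : (x - y @[x --> y] --> (0 : Y))%classic.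
  by rewrite -(subrr y); apply: tvs_cvgB; [exact: cvg_id|exact: cvg_cst].
have cvgN : (y - x @[x --> y] --> (0 : Y))%classic.
  by rewrite -(subrr y); apply: tvs_cvgB; [exact: cvg_cst|exact: cvg_id].
near=> x.
have g1 : g (x - y) <= e by near: x; exact: (cvgB _ (gsmall _ e0)).
have g2 : g (y - x) <= e by near: x; exact: (cvgN _ (gsmall _ e0)).
have := fg y (x - y); have := fg x (y - x).
rewrite ![_ + (_ - _)]addrC !subrK ler_norml; lra.
Unshelve. all: by end_near. Qed.

(** * The functionals of a closed convex set and of its recession cone *)

Theorem proposition16 (R : realType) (Y : tvsType R)
    (hausY : hausdorff_space Y)
    (A : set Y) (A_nonempty : A !=set0) (A_neqY : A <> [set: Y])
    (A_closed : closed A) (A_convex : @convex_set R Y A)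
    (k : Y) (hk : [set - u | u in interior (recession_cone A)] k) :
  [/\ finite_valued (phi A k),
      continuous (real_fun (phi A k)) &
      @convex_function R Y [set: Y] (real_fun (phi A k))] /\
  [/\ finite_valued (phi (recession_cone A) k),
      continuous (real_fun (phi (recession_cone A) k)) &
      sublinear (real_fun (phi (recession_cone A) k))] /\
  (forall (ybar : Y) (ystar : {linear Y -> R^o}),
      subdifferential (real_fun (phi A k)) ybar ystar ->
      forall y : Y,
        ystar (y - ybar) <= real_fun (phi (recession_cone A) k) (y - ybar)).
Proof.
have {hk} [u Cu ku] := hk; have {u Cu ku} Ck : nbhs (- k) (recession_cone A).
  by rewrite -ku opprK.
set C := recession_cone A in Ck *.
have CT : C <> [set: Y] by exact: recession_cone_neqT.
have C0 : C 0 by exact: recession_cone0.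
have Cne : C !=set0 by exists 0.
have CD : forall u v, C u -> C v -> C (u + v) := @recession_coneD _ _ A.
have CZ : forall (s : R) u, 0 <= s -> C u -> C (s *: u) := @recession_coneZ _ _ A.
have A_act : forall a u, A a -> C u -> A (a + u) := @recession_cone_act _ _ A.
have addA := real_fun_phi_add CD CZ Ck CT C0 A_act A_nonempty A_neqY.
have addC := real_fun_phi_add CD CZ Ck CT C0 CD Cne CT.
have smallC := phi_cone_small CD CZ Ck CT C0.
split; [|split].
- split; first exact: finite_valued_phi CZ Ck _ A_act A_nonempty A_neqY.
  + exact: continuous_of_subadd addA smallC.
  + exact: convex_real_fun_phi CZ Ck _ A_act A_nonempty A_neqY A_convex.
- split; first exact: finite_valued_phi CZ Ck _ CD Cne CT.
  + exact: continuous_of_subadd addC smallC.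
  + by split=> // t x; exact: phi_coneZ.
- move=> ybar ystar [_ subg] y; apply: le_trans (subg y) _.
  by rewrite lerBlDl -{1}(subrK ybar y) addrC; exact: addA.
Qed.
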